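(* There exists an absolute constant $c_1 > 0$ such that the following holds. Let $d \ge 1$ be an integer and let $(X, \mathcal{F})$ be a finite set system such that $|\mathcal{F}|_Y| \leq \left( e |Y|/d \right)^d$ for all $Y \subseteq X$ with $|Y| \geq d$. Let $0 < \delta, \epsilon, \gamma < 1/2$ be given parameters. Then for any integer $t$ with $t \le |X|$ and $$t \geq \frac{c_1}{\epsilon \delta^2} \cdot \left( d \ln \frac{1}{\epsilon \delta} + \ln \frac{1}{\gamma} \right),$$ a uniform random sample $A \subseteq X$ of size $t$ is a relative $(\epsilon,\delta)$-approximation for $(X,\mathcal{F})$ with probability at least $1 - \gamma$.
   Context: A finite set system $(X,\mathcal{F})$ consists of a finite set $X$ and a family $\mathcal{F}$ of subsets of $X$. For $Y \subseteq X$, $\mathcal{F}|_Y = \{ Y \cap S : S \in \mathcal{F} \}$. Here $e$ is the base of the natural logarithm. A uniform random sample of $X$ of size $t$ is a set $A$ selected uniformly at random from the $\binom{|X|}{t}$ subsets of $X$ of size $t$. With $n = |X|$, a set $A \subseteq X$ of size $t$ is a relative $(\epsilon,\delta)$-approximation for $(X,\mathcal{F})$ if for all $S \in \mathcal{F}$, $$\left| \frac{|S|}{n} - \frac{|A \cap S|}{t} \right| \leq \delta \cdot \max\left\{ \frac{|S|}{n}, \epsilon \right\}.$$ ''Absolute constant'' means that $c_1$ does not depend on $X$, $\mathcal{F}$, $d$, $\epsilon$, $\delta$, $\gamma$ or $t$. *)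

(* Defs.v *)
From mathcomp Require Import all_boot all_order all_algebra.
From mathcomp Require Import reals sequences exp.

Set Implicit Arguments.
Unset Strict Implicit.
Unset Printing Implicit Defensive.

Import Order.TTheory GRing.Theory Num.Theory.

Local Open Scope ring_scope.

(* A finite set system is a ground finType X together with a
   family F : {set {set X}} of its subsets. *)

Definition projection (X : finType) (F : {set {set X}}) (Y : {set X}) :
    {set {set X}} :=
  [set Y :&: S | S in F].

(* The size t of the sample is #|A|. *)
Definition relative_approximation (R : realType) (X : finType)
    (F : {set {set X}}) (eps delta : R) (A : {set X}) : bool :=
  [forall S in F,
     `| #|S|%:R / #|X|%:R - #|A :&: S|%:R / #|A|%:R |
       <= delta * Num.max (#|S|%:R / #|X|%:R) eps].

Definition subsets_of_size (X : finType) (t : nat) : {set {set X}} :=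
  [set A : {set X} | #|A| == t].

(* The sample space is nonempty, so that this is a probability, exactly when
   t <= #|X|; it then has 'C(#|X|, t) elements. *)
Definition uniform_sample_prob (R : realType) (X : finType) (t : nat)
    (E : pred {set X}) : R :=
  #|[set A in subsets_of_size X t | E A]|%:R / #|subsets_of_size X t|%:R.

(* Main.v *)
(* Join the sample to X by a chain of uniform samples A = Y_0, Y_1, ..., Y_k = X,
   each Y_i being a uniform subset of Y_(i+1) of half its size (the last step
   is at most a halving).  Given Y_(i+1), a Chernoff bound for
   the hypergeometric law and a union bound over the trace of F on Y_(i+1),
   which has at most (e |Y_(i+1)| / d)^d members, control the error of Y_i
   relative to Y_(i+1).  If the error allowed at size 2^i t is
   proportional to (3/4)^i delta, then the exponent eps delta^2 t gains a factor
   9/8 at each doubling, which beats the factor 2^d gained by the trace bound: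
   the failure probabilities decrease geometrically and the last halving
   dominates. *)
Require Import Defs.
From mathcomp Require Import all_boot all_order all_algebra.
From mathcomp Require Import reals sequences exp.
From mathcomp Require Import zify ring lra.

Import Order.TTheory GRing.Theory Num.Theory.

Local Open Scope ring_scope.

(** * Counting subsets and binomial coefficients *)

Lemma card_between {X : finType} (J B : {set X}) (t : nat) :
  J \subset B -> (#|J| <= t)%N ->
  #|[set A : {set X} | [&& J \subset A, A \subset B & #|A| == t]]|
    = 'C(#|B| - #|J|, t - #|J|).
Proof.
move=> JB Jt; rewrite -(cardsDS JB) -cards_draws.
rewrite -[RHS](@card_in_imset _ _ (fun C => J :|: C)).
  apply: eq_card => A; rewrite inE; apply/idP/imsetP.
    case/and3P=> JA AB /eqP At; exists (A :\: J).
      by rewrite inE setSD //= cardsDS // At.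
    by rewrite setDE setUIr setUCr setIT; apply/esym/setUidPr.
  case=> C; rewrite inE subsetD => /andP[/andP[CB CJ] /eqP Ct] ->.
  rewrite subsetUl subUset JB CB cardsU Ct setIC (disjoint_setI0 CJ) cards0.
  by rewrite subn0 subnKC //=.
move=> C D; rewrite !inE !subsetD => /andP[/andP[_ CJ] _] /andP[/andP[_ DJ] _].
move=> /setP E; apply/setP => x; move: (E x); rewrite !inE.
case xJ: (x \in J) => //= _.
by rewrite (disjointFl CJ xJ) (disjointFl DJ xJ).
Qed.

Lemma sum_powerset_expr {R : realFieldType} {X : finType} (D : {set X}) (y : R) :
  \sum_(J : {set X} | J \subset D) y ^+ #|J| = (1 + y) ^+ #|D|.
Proof.
rewrite exprDn (partition_big (fun J : {set X} => inord #|J| : 'I_#|D|.+1) xpredT) //=.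
apply: eq_bigr => j _; rewrite expr1n mul1r -cards_draws -sumr_const.
apply: eq_big => [J|J /andP[JD /eqP <-]].
  rewrite inE; case JD: (J \subset D) => //=.
  by rewrite -val_eqE /= inordK // ltnS subset_leq_card.
by rewrite inordK // ltnS subset_leq_card.
Qed.

(** In the ratio C(K, j) / C(N, j) of falling factorials, every factor (K - i) / (N - i) is at most
    K / N. *)
Lemma bin_mul_expn_le (K N j : nat) :
  (K <= N -> 'C(K, j) * N ^ j <= 'C(N, j) * K ^ j)%N.
Proof.
move=> KN; rewrite -(leq_pmul2r (fact_gt0 j)) mulnAC bin_ffact.
rewrite [leqRHS]mulnAC bin_ffact.
elim: j => [|j IH]; first by rewrite !ffactn0 !expn0.
rewrite !ffactnSr !expnSr [leqLHS]mulnACA [leqRHS]mulnACA leq_mul //.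
by rewrite !mulnBl mulnC leq_sub2l // leq_mul2l KN orbT.
Qed.

(** Both sides count the pairs J ⊆ A of sizes j and t in an N-set. In [failure_prob_halving] this
    makes a uniform t-subset of a uniform N-subset a uniform t-subset of X. *)
Lemma mul_bin_bin (N t j : nat) :
  (j <= t -> t <= N -> 'C(N, t) * 'C(t, j) = 'C(N, j) * 'C(N - j, t - j))%N.
Proof.
move=> jt tN; have f0 := fact_gt0.
have e1 := bin_fact tN; have e2 := bin_fact jt.
have e3 := bin_fact (leq_trans jt tN).
have e4 := bin_fact (leq_sub2r j tN).
have E : (N - j - (t - j) = N - t)%N by lia.
rewrite E in e4.
apply/eqP.
rewrite -(eqn_pmul2r (f0 j)) -(eqn_pmul2r (f0 (t - j)%N)) -(eqn_pmul2r (f0 (N - t)%N)).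
apply/eqP; transitivity N`!.
  by rewrite -e1 -e2; ring.
by rewrite -e3 -e4; ring.
Qed.

(** * Generating function and tails of the hypergeometric law *)

Definition subsets_in {X : finType} (B : {set X}) (t : nat) : {set {set X}} :=
  [set A : {set X} | A \subset B & #|A| == t].

Lemma hypergeometric_mgf_ge1_le {R : realFieldType} {X : finType} (B T : {set X})
    (t : nat) (y : R) :
  T \subset B -> (0 < t <= #|B|)%N -> 0 <= y ->
  \sum_(A in subsets_in B t) (1 + y) ^+ #|A :&: T|
    <= 'C(#|B|, t)%:R * (1 + #|T|%:R / #|B|%:R * y) ^+ t.
Proof.
move=> TB /andP[t0 tB] y0.
(* Expanding (1 + y)^|A :&: T| over the subsets J of A :&: T reduces the bound
   to P(J \subset A) <= C(t, j) / C(K, j) (K / N)^j with |J| = j, |T| = K,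
   |B| = N. *)
under eq_bigr => A _ do rewrite -sum_powerset_expr.
rewrite (exchange_big_dep (fun J : {set X} => J \subset T)) /=; last first.
  by move=> A J _; rewrite subsetI => /andP[].
(* The guard matters: for |J| > t no A contains J, whereas truncated subtraction would turn the
   binomial into C(|B| - |J|, 0) = 1. *)
have -> : \sum_(J : {set X} | J \subset T)
    \sum_(A in subsets_in B t | J \subset A :&: T) y ^+ #|J|
   = \sum_(J : {set X} | J \subset T)
      (if (#|J| <= t)%N then 'C(#|B| - #|J|, t - #|J|)%:R * y ^+ #|J| else 0).
  apply: eq_bigr => J JT; case: ifP => Jt.
    rewrite -card_between ?(subset_trans JT TB) // mulr_natl -sumr_const.
    apply: eq_bigl => A; rewrite !inE subsetI JT andbT.
    by case: (J \subset A); rewrite ?andbT ?andbF.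
  rewrite big1 // => A; rewrite !inE subsetI => /andP[/andP[_ /eqP At] /andP[JA _]].
  by move: (subset_leq_card JA); rewrite At Jt.
rewrite -big_mkcondr /=.
(* Group by size; [inord] is faithful because only sets with |J| <= t remain in the sum. *)
rewrite (partition_big (fun J : {set X} => inord #|J| : 'I_t.+1) xpredT) //=.
rewrite exprDn mulr_sumr; apply: ler_sum => j _.
have jt : (j <= t)%N by rewrite -ltnS.
apply: (@le_trans _ _ (('C(#|T|, j) * 'C(#|B| - j, t - j))%:R * y ^+ j)).
  rewrite natrM -mulrA -cards_draws mulr_natl -sumr_const.
  rewrite le_eqVlt; apply/orP; left; apply/eqP.
  apply: eq_big => [J|J /andP[/andP[_ Jt] /eqP <-]]; last by rewrite inordK.
  rewrite inE -andbA; case: (J \subset T) => //=.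
  apply/andP/eqP => [[Jt /eqP <-]|Jj]; first by rewrite inordK.
  by rewrite Jj jt; split=> //; rewrite -val_eqE /= inordK ?Jj.
rewrite expr1n mul1r exprMn -[_ *+ 'C(t, j)]mulr_natr.
have -> : 'C(#|B|, t)%:R * ((#|T|%:R / #|B|%:R) ^+ j * y ^+ j * 'C(t, j)%:R)
    = ('C(#|B|, t) * 'C(t, j))%:R * (#|T|%:R / #|B|%:R) ^+ j * y ^+ j :> R.
  by rewrite natrM; ring.
rewrite ler_wpM2r ?exprn_ge0 //.
have B0 : (0 < #|B|)%N by apply: leq_trans tB.
rewrite expr_div_n mulrA ler_pdivlMr ?exprn_gt0 ?ltr0n //.
rewrite -!natrX -!natrM ler_nat mul_bin_bin // mulnAC [leqRHS]mulnAC leq_mul //.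
by rewrite bin_mul_expn_le // subset_leq_card.
Qed.

(** The right side is C(|B|, t) times the generating function of a binomial law with t trials and
    success probability |T| / |B|. Values z < 1 serve the lower tail. *)
Lemma hypergeometric_mgf_le {R : realFieldType} {X : finType} (B T : {set X}) (t : nat) (z : R) :
  T \subset B -> (0 < t <= #|B|)%N -> 0 < z ->
  \sum_(A in subsets_in B t) z ^+ #|A :&: T|
    <= 'C(#|B|, t)%:R * (1 + #|T|%:R / #|B|%:R * (z - 1)) ^+ t.
Proof.
move=> TB tB z0; have [z1|z1] := leP 1 z.
  have := @hypergeometric_mgf_ge1_le _ _ _ _ _ (z - 1) TB tB; rewrite subr_ge0 => /(_ z1).
  by under eq_bigr do rewrite subrKC.
(* z^|A :&: T| = z^t (1/z)^|A :\: T|, and 1/z > 1. *)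
have BTB : B :\: T \subset B by rewrite subsetDl.
have y0 : 0 <= z^-1 - 1 by rewrite subr_ge0 invf_ge1 // ltW.
have := hypergeometric_mgf_ge1_le _ _ _ _ BTB tB y0; rewrite subrKC.
rewrite -(ler_pM2l (exprn_gt0 t z0)) mulr_sumr mulrCA -exprMn.
have B0 : #|B|%:R != 0 :> R.
  by rewrite pnatr_eq0 -lt0n; case/andP: tB => t0; apply: leq_trans.
have -> : z * (1 + #|B :\: T|%:R / #|B|%:R * (z^-1 - 1))
   = 1 + #|T|%:R / #|B|%:R * (z - 1).
  rewrite cardsDS // natrB ?subset_leq_card //; field.
  by rewrite B0 gt_eqF.
apply: le_trans; rewrite le_eqVlt; apply/orP; left; apply/eqP.
apply: eq_bigr => A; rewrite inE => /andP[AB /eqP <-].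
have -> : A :&: (B :\: T) = A :\: T by rewrite setIDA (setIidPl AB).
by rewrite -(cardsID T A) exprD exprVn mulfK // expf_neq0 // gt_eqF.
Qed.

(** From 1 - s <= exp(-s) one gets exp(s) <= 1 / (1 - s), and (1 + s + 2s²)(1 - s) = 1 + s²(1 - 2s)
    >= 1. *)
Lemma expR_le_quadratic {R : realType} (s : R) :
  `|s| <= 1 / 2 -> expR s <= 1 + s + 2 * s ^+ 2.
Proof.
rewrite ler_norml => /andP[s1 s2].
have h := expR_ge1Dx (- s); have e0 := expR_gt0 s.
have e1 : expR s * expR (- s) = 1 by rewrite -expRD subrr expR0.
have h1 : expR s * (1 - s) <= 1 by rewrite -[leRHS]e1 ler_pM2l.
have s0 : 0 < 1 - s by lra.
rewrite -(ler_pM2r s0); apply: le_trans h1 _.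
have : 0 <= s ^+ 2 * (1 - 2 * s) by rewrite mulr_ge0 ?sqr_ge0 //; lra.
by nra.
Qed.

(** Markov's inequality for exp(s · deviation), with the generating function taken at z = exp(s).
    The sign of [s] selects the tail; centring cancels the linear term tps and leaves 2tps². *)
Lemma hypergeometric_chernoff {R : realType} {X : finType} (B T : {set X}) (t : nat) (s theta : R) :
  T \subset B -> (0 < t <= #|B|)%N -> `|s| <= 1 / 2 ->
  #|[set A in subsets_in B t | theta <= s * (#|A :&: T|%:R - t%:R * (#|T|%:R / #|B|%:R))]|%:R
    <= 'C(#|B|, t)%:R * expR (2 * t%:R * (#|T|%:R / #|B|%:R) * s ^+ 2 - theta).
Proof.
move=> TB tB s1; set p : R := _ / _.
have p0 : 0 <= p by rewrite divr_ge0.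
apply: (@le_trans _ _
  (\sum_(A in subsets_in B t) expR (s * (#|A :&: T|%:R - t%:R * p) - theta))).
  rewrite cardE -sum1_size natr_sum big_enum /=.
  rewrite (eq_bigl (fun A => (A \in subsets_in B t) && 
     (theta <= s * (#|A :&: T|%:R - t%:R * p)))); last by move=> A; rewrite inE.
  rewrite big_mkcondr; apply: ler_sum => A _; case: ifP => [h|_]; last exact: expR_ge0.
  by rewrite -[leLHS]expR0 ler_expR subr_ge0.
under eq_bigr => A _.
  rewrite (_ : _ - theta = #|A :&: T|%:R * s + (- s * t%:R * p - theta)); last by ring.
  rewrite expRD expRM_natl; over.
rewrite -mulr_suml.
apply: le_trans (ler_wpM2r (expR_ge0 _) (hypergeometric_mgf_le _ _ _ _ TB tB (expR_gt0 s))) _.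
rewrite -[leLHS]mulrA ler_wpM2l //.
have q0 : 0 <= 1 + p * (expR s - 1).
  have : p <= 1.
    rewrite ler_pdivrMr ?mul1r ?ler_nat ?subset_leq_card //.
    by rewrite ltr0n; case/andP: tB => t0; apply: leq_trans.
  by have := expR_gt0 s; nra.
have q1 : 1 + p * (expR s - 1) <= expR (p * (s + 2 * s ^+ 2)).
  apply: le_trans (expR_ge1Dx _); rewrite lerD2l ler_wpM2l //.
  by have := expR_le_quadratic _ s1; lra.
apply: (@le_trans _ _ (expR (p * (s + 2 * s ^+ 2)) ^+ t * expR (- s * t%:R * p - theta))).
  by rewrite ler_wpM2r ?expR_ge0 // lerXn2r // nnegrE expR_ge0.
rewrite -expRM_natl -expRD ler_expR le_eqVlt; apply/orP; left; apply/eqP; ring.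
Qed.


(** * Union bound over the trace *)

Lemma card_deviating_le {R : realType} {X : finType} (B T : {set X}) (t : nat)
    (eps delta : R) :
  T \subset B -> (0 < t <= #|B|)%N -> 0 < delta <= 1 ->
  #|[set A in subsets_in B t |
      ~~ (`| #|T|%:R / #|B|%:R - #|A :&: T|%:R / #|A|%:R |
            <= delta * Num.max (#|T|%:R / #|B|%:R) eps)]|%:R
    <= 'C(#|B|, t)%:R * (2 * expR (- (eps * delta ^+ 2 * t%:R / 8))).
Proof.
move=> TB tB /andP[d0 d1]; set p : R := #|T|%:R / _; set M := Num.max p eps.
(* One tail for each of s = ± delta / 4. As p <= M, the exponent 2tp(delta/4)² - delta² t M / 4 is
   at most -delta² t M / 8, and then eps <= M applies. *)
pose U (s : R) := [set A in subsets_in B t |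
   delta ^+ 2 / 4 * t%:R * M <= s * (#|A :&: T|%:R - t%:R * p)].
have t0 : 0 < t%:R :> R by rewrite ltr0n; case/andP: tB.
have [pM eM] : p <= M /\ eps <= M by rewrite !le_max !lexx orbT.
have hU s : s ^+ 2 = (delta / 4) ^+ 2 ->
    #|U s|%:R <= 'C(#|B|, t)%:R * expR (- (eps * delta ^+ 2 * t%:R / 8)).
  move=> s2; have s1 : `|s| <= 1 / 2.
    by rewrite ler_norml; apply/andP; split; nra.
  apply: le_trans (hypergeometric_chernoff _ _ _ _ _ TB tB s1) _; rewrite -/p s2.
  rewrite ler_wpM2l // ler_expR.
  have : 0 <= t%:R * delta ^+ 2 * (M - p) by rewrite !mulr_ge0 ?sqr_ge0 // ?subr_ge0 // ltW.
  have : 0 <= t%:R * delta ^+ 2 * (M - eps) by rewrite !mulr_ge0 ?sqr_ge0 // ?subr_ge0 // ltW.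
  by lra.
apply: (@le_trans _ _ (#|U (delta / 4)|%:R + #|U (- (delta / 4))|%:R)).
  rewrite -natrD ler_nat; apply: leq_trans (leq_card_setU _ _).
  apply/subset_leq_card/subsetP => A; rewrite !inE -/p.
  case/andP=> /andP[-> /eqP ->] /=; rewrite -ltNge lter_normr => h.
  set a : R := #|A :&: T|%:R in h *; rewrite eqxx /=.
  have e : t%:R * (a / t%:R) = a by rewrite mulrCA divff ?mulr1 // gt_eqF.
  have td : 0 < t%:R * delta by rewrite mulr_gt0.
  case/orP: h => h; apply/orP; [right|left];
    have := ltW h; rewrite -(ler_pM2l td) => {}h; rewrite -[a]e; lra.
by rewrite mulr2n mulrDl mul1r mulrDr lerD // hU // sqrrN.
Qed.

(** Phrased with subsets of [X] instead of a subtype carried by [B], so that all members of the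
    chain live in one type. *)
Definition approx_on {R : realType} {X : finType} (F : {set {set X}}) (B : {set X})
    (eps delta : R) (A : {set X}) : bool :=
  [forall T in projection F B,
     `| #|T|%:R / #|B|%:R - #|A :&: T|%:R / #|A|%:R |
       <= delta * Num.max (#|T|%:R / #|B|%:R) eps].

Lemma card_not_approx_on_le {R : realType} {X : finType} (F : {set {set X}})
    (B : {set X}) (t : nat) (eps delta : R) :
  (0 < t <= #|B|)%N -> 0 < delta <= 1 ->
  #|[set A in subsets_in B t | ~~ approx_on F B eps delta A]|%:R
    <= 'C(#|B|, t)%:R *
       (#|projection F B|%:R * (2 * expR (- (eps * delta ^+ 2 * t%:R / 8)))).
Proof.
move=> tB d01; rewrite mulrCA [#|projection F B|%:R * _]mulr_natl -[leRHS]sumr_const.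
pose D (T : {set X}) := [set A in subsets_in B t |
      ~~ (`| #|T|%:R / #|B|%:R - #|A :&: T|%:R / #|A|%:R |
            <= delta * Num.max (#|T|%:R / #|B|%:R) eps)].
apply: (@le_trans _ _ (\sum_(T in projection F B) #|D T|%:R)); last first.
  apply: ler_sum => T /imsetP[S SF ->]; apply: card_deviating_le => //.
  exact: subsetIl.
rewrite -natr_sum ler_nat.
apply: (@leq_trans #|\bigcup_(T in projection F B) D T|).
  apply/subset_leq_card/subsetP => A; rewrite !inE => /andP[AB].
  case/forall_inPn => T TF h; apply/bigcupP; exists T => //.
  by rewrite !inE AB.
elim/big_ind2: _ => [|m A n C Am Cn|//]; first by rewrite cards0.
by apply: leq_trans (leq_card_setU _ _) (leq_add _ _).
Qed.

(** * Two-stage sampling *)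

(** The error splits as 3/4 + 1/4 of delta. Measured in B, the maximum grows by at most 1 + 3 delta
    / 4 <= 11/8, and 1/6 · 11/8 < 1/4. *)
Lemma relative_approximation_trans {R : realType} {X : finType} (F : {set {set X}})
    (B A : {set X}) (eps delta : R) :
  A \subset B -> 0 < eps -> 0 < delta <= 1 / 2 ->
  relative_approximation F eps (3 / 4 * delta) B ->
  approx_on F B eps (delta / 6) A ->
  relative_approximation F eps delta A.
Proof.
move=> AB e0 /andP[d0 d1] /forall_inP hB /forall_inP hA; apply/forall_inP => S SF.
have := hB S SF; have := hA (B :&: S) (imset_f _ SF).
rewrite setIA (setIidPl AB).
set q : R := #|S|%:R / _; set r : R := #|B :&: S|%:R / _; set a : R := #|A :&: S|%:R / _.
have [qM eM] : q <= Num.max q eps /\ eps <= Num.max q eps by rewrite !le_max !lexx orbT.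
move: (Num.max q eps) qM eM => M qM eM ha hb.
have dM : 0 < delta * M by rewrite mulr_gt0 //; lra.
have hM : Num.max r eps <= (1 + 3 / 4 * delta) * M.
  move: hb; rewrite ler_norml => /andP[hb1 hb2].
  by rewrite ge_max; apply/andP; split; lra.
have h : `|r - a| <= delta / 4 * M.
  apply: (le_trans ha).
  have : delta / 6 * Num.max r eps <= delta / 6 * ((1 + 3 / 4 * delta) * M).
    by rewrite ler_wpM2l //; lra.
  have : delta * (delta * M) <= 1 / 2 * (delta * M) by rewrite ler_wpM2r // ltW.
  by lra.
rewrite (_ : q - a = (q - r) + (r - a)); last by ring.
by apply: le_trans (ler_normD _ _) _; lra.
Qed.

Lemma relative_approximationE {R : realType} {X : finType} (F : {set {set X}})
    (eps delta : R) (A : {set X}) :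
  relative_approximation F eps delta A = approx_on F setT eps delta A.
Proof.
apply/forall_inP/forall_inP => h => [T /imsetP[S SF ->]|S SF].
  by rewrite setTI cardsT h.
by have := h (setT :&: S) (imset_f _ SF); rewrite setTI cardsT.
Qed.

Lemma subsets_of_sizeE {X : finType} (t : nat) : subsets_of_size X t = subsets_in setT t.
Proof. by apply/setP => A; rewrite !inE subsetT. Qed.

Lemma card_subsets_of_size {X : finType} (t : nat) : #|subsets_of_size X t| = 'C(#|X|, t).
Proof. by rewrite subsets_of_sizeE cards_draws cardsT. Qed.

Definition failure_prob {R : realType} {X : finType} (F : {set {set X}}) (t : nat)
    (eps delta : R) : R :=
  uniform_sample_prob R t (fun A => ~~ relative_approximation F eps delta A).

(** Sampling from [X] in a single step; this ends the chain. *)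
Lemma failure_prob_union_bound {R : realType} {X : finType} (F : {set {set X}}) (t : nat)
    (eps delta : R) :
  (0 < t <= #|X|)%N -> 0 < delta <= 1 ->
  failure_prob F t eps delta
    <= #|projection F setT|%:R * (2 * expR (- (eps * delta ^+ 2 * t%:R / 8))).
Proof.
move=> tX d01; rewrite /failure_prob /uniform_sample_prob card_subsets_of_size.
rewrite ler_pdivrMr ?ltr0n ?bin_gt0; last by case/andP: tX.
rewrite mulrC; have := @card_not_approx_on_le R X F setT t eps delta.
rewrite cardsT => /(_ tX d01); apply: le_trans; rewrite ler_nat.
apply/subset_leq_card/subsetP => A; rewrite !inE relative_approximationE.
by rewrite subsetT.
Qed.

(** Draw B of size N, then A inside B. If A fails, then B fails at 3/4 delta or A fails relative to
    B at delta / 6; [a] bounds the latter probability for every B. *)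
Lemma failure_prob_halving {R : realType} {X : finType} (F : {set {set X}}) (t N : nat)
    (eps delta a : R) :
  (t <= N <= #|X|)%N -> 0 < eps -> 0 < delta <= 1 / 2 -> 0 <= a ->
  (forall B : {set X}, #|B| = N ->
     #|[set A in subsets_in B t | ~~ approx_on F B eps (delta / 6) A]|%:R
       <= 'C(N, t)%:R * a) ->
  failure_prob F t eps delta <= failure_prob F N eps (3 / 4 * delta) + a.
Proof.
move=> /andP[tN NX] e0 d01 a0 ha.
rewrite /failure_prob /uniform_sample_prob !card_subsets_of_size.
set bad := [set _ in _ | _]; set badN := [set _ in _ | _].
have Ct : 0 < 'C(#|X|, t)%:R :> R by rewrite ltr0n bin_gt0 (leq_trans tN).
have CN : 0 < 'C(#|X|, N)%:R :> R by rewrite ltr0n bin_gt0.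
have CtN : 0 < 'C(N, t)%:R :> R by rewrite ltr0n bin_gt0.
have Cc : 0 < 'C(#|X| - t, N - t)%:R :> R by rewrite ltr0n bin_gt0 leq_sub2r.
rewrite ler_pdivrMr // -(ler_pM2r Cc).
have E : 'C(#|X|, t)%:R * 'C(#|X| - t, N - t)%:R = 'C(#|X|, N)%:R * 'C(N, t)%:R :> R.
  by rewrite -!natrM mul_bin_bin.
rewrite -mulrA E mulrDl mulrA divfK ?gt_eqF //.
(* Count the pairs (A, B) with A bad and A ⊆ B, first by A and then by B. *)
have -> : #|bad|%:R * 'C(#|X| - t, N - t)%:R
   = \sum_(A in bad) \sum_(B : {set X} | (A \subset B) && (#|B| == N)) 1 :> R.
  rewrite mulr_natl -sumr_const; apply: eq_bigr => A.
  rewrite !inE => /andP[/eqP At _].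
  rewrite sumr_const -cardsT -At -card_between ?subsetT ?At //.
  by congr (_%:R); apply: eq_card => B; rewrite !inE subsetT.
rewrite (exchange_big_dep (fun B : {set X} => #|B| == N)) /=; last by move=> A B _ /andP[].
(* A failing B may spoil all of its C(N, t) subsets; any other B spoils at most the fraction [a]. *)
apply: (@le_trans _ _ (\sum_(B : {set X} | #|B| == N)
    ((if ~~ relative_approximation F eps (3 / 4 * delta) B then 'C(N, t)%:R else 0)
      + a * 'C(N, t)%:R))).
  apply: ler_sum => B /eqP BN.
  have -> : \sum_(A in bad | (A \subset B) && (#|B| == N)) 1
     = #|[set A in subsets_in B t | ~~ relative_approximation F eps delta A]|%:R :> R.
    rewrite sumr_const; congr (_%:R); apply: eq_card => A.
    rewrite -topredE /= !inE BN eqxx.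
    by case: (A \subset B); case: (#|A| == t); case: relative_approximation.
  case: ifP => [_|/negbFE hB].
    rewrite -[X in X <= _]addr0 lerD ?mulr_ge0 // ler_nat -BN -cards_draws.
    by apply/subset_leq_card/subsetP => A; rewrite !inE => /andP[].
  rewrite add0r mulrC; apply: le_trans (ha B BN); rewrite ler_nat.
  apply/subset_leq_card/subsetP => A; rewrite !inE => /andP[/andP[AB ->] hA].
  rewrite AB /=; apply: contra hA; exact: relative_approximation_trans hB.
rewrite big_split /= -big_mkcondr /= !sumr_const.
have -> : #|[pred B : {set X} | #|B| == N]| = 'C(#|X|, N).
  by rewrite -card_subsets_of_size; apply: eq_card => B; rewrite !inE.
have -> : #|[pred B : {set X} | (#|B| == N)
    && ~~ relative_approximation F eps (3 / 4 * delta) B]| = #|badN|.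
  by apply: eq_card => B; rewrite !inE.
rewrite -[X in X + _ <= _]mulr_natl -[X in _ + X <= _]mulr_natl.
by rewrite mulrCA.
Qed.


(** * Induction along the chain *)

(** Induction on |X| - t, passing from t to 2t. The constant 288 = 8 · 6² is the Chernoff exponent
    at delta / 6. With P the trace bound at size 2t, the current halving costs 2 P exp(-lam) and all
    larger ones together at most as much again, whence the factor 4. The last hypothesis survives
    doubling because lam grows. *)
Lemma failure_prob_le {R : realType} {X : finType} (F : {set {set X}}) (d t : nat)
    (eps delta : R) :
  (forall Y : {set X}, (d <= #|Y|)%N ->
     #|projection F Y|%:R <= (expR 1 * #|Y|%:R / d%:R) ^+ d :> R) ->
  (0 < t)%N -> (d <= t <= #|X|)%N -> 0 < eps -> 0 < delta <= 1 / 2 ->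
  2 ^+ d.+1 <= expR (eps * delta ^+ 2 * t%:R / 288 / 8) ->
  failure_prob F t eps delta
    <= 4 * (expR 1 * (2 * t%:R) / d%:R) ^+ d
         * expR (- (eps * delta ^+ 2 * t%:R / 288)).
Proof.
move=> trF t0 dtX e0.
have [m] := ubnP (#|X| - t)%N.
elim: m t delta t0 dtX => // m IH t delta t0 /andP[dt tX] mt /andP[d0 d1].
set lam := eps * delta ^+ 2 * t%:R / 288 => hlam.
set P := (expR 1 * (2 * t%:R) / d%:R) ^+ d.
have lam0 : 0 <= lam by rewrite /lam divr_ge0 // !mulr_ge0 ?exprn_ge0 // ltW.
have P0 : 0 <= P by rewrite /P exprn_ge0 // divr_ge0 // !mulr_ge0 ?expR_ge0.
have PY (Y : {set X}) : (d <= #|Y| <= 2 * t)%N -> #|projection F Y|%:R <= P.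
  move=> /andP[dY Yt]; apply: (le_trans (trF Y dY)).
  rewrite lerXn2r ?nnegrE ?divr_ge0 ?mulr_ge0 ?expR_ge0 //.
  by rewrite ler_wpM2r ?invr_ge0 // ler_wpM2l ?expR_ge0 // -natrM ler_nat.
have el0 := expR_ge0 (- lam).
have d1' : 0 < delta <= 1 by apply/andP; split; lra.
(* If |X| <= 2t, then P already bounds the trace on [X] itself, and one union bound suffices. *)
have [nt|nt] := leqP #|X| (2 * t).
  apply: le_trans (failure_prob_union_bound _ _ _ _ _ d1') _; first by rewrite t0.
  apply: (@le_trans _ _ (P * (2 * expR (- lam)))); last first.
    by have := mulr_ge0 P0 el0; nra.
  apply: ler_pM => //; first by rewrite mulr_ge0 ?expR_ge0.
    by rewrite PY // cardsT nt andbT (leq_trans dt).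
  by rewrite ler_pM2l // ler_expR lerN2 /lam in lam0 *; lra.
have d1'' : 0 < delta <= 1 / 2 by rewrite d0.
apply: le_trans (failure_prob_halving _ _ (2 * t)%N _ _ (P * (2 * expR (- lam))) _ e0 d1'' _ _) _.
- by rewrite (ltnW nt) andbT leq_pmull.
- by rewrite !mulr_ge0.
- move=> B BN; have tB : (0 < t <= #|B|)%N by rewrite BN t0 leq_pmull.
  have d6 : 0 < delta / 6 <= 1 by apply/andP; split; lra.
  apply: le_trans (card_not_approx_on_le F _ _ eps _ tB d6) _; rewrite BN ler_wpM2l //.
  rewrite ler_pM ?mulr_ge0 ?expR_ge0 //.
    by rewrite PY // BN leqnn andbT (leq_trans dt) // leq_pmull.
  rewrite ler_pM2l // ler_expR lerN2 le_eqVlt; apply/orP; left; apply/eqP.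
  by rewrite /lam; field.
have lamE : eps * (3 / 4 * delta) ^+ 2 * (2 * t)%:R / 288 = lam + lam / 8.
  by rewrite natrM /lam; field.
have IHt : failure_prob F (2 * t)%N eps (3 / 4 * delta) <=
    4 * (expR 1 * (2 * (2 * t)%:R) / d%:R) ^+ d * expR (- (lam + lam / 8)).
  rewrite -lamE; apply: IH; first by rewrite muln_gt0.
  - by rewrite (ltnW nt) andbT (leq_trans dt) // leq_pmull.
  - by lia.
  - by apply/andP; split; lra.
  by rewrite lamE; apply: (le_trans hlam); rewrite ler_expR; lra.
(* Doubling multiplies the bound by 2^d expR (- lam / 8) <= 1 / 2. *)
have half : 2 ^+ d * expR (- (lam / 8)) <= 1 / 2.
  rewrite expRN ler_pdivrMr ?expR_gt0 // -(ler_pM2l (ltr0n R 2)).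
  by rewrite -exprS; apply: (le_trans hlam); lra.
have PE : (expR 1 * (2 * (2 * t)%:R) / d%:R) ^+ d = 2 ^+ d * P.
  by rewrite -exprMn natrM; congr (_ ^+ _); ring.
move: IHt; rewrite PE opprD expRD => IHt.
have := ler_wpM2l (mulr_ge0 P0 el0) half; lra.
Qed.

(** * Complementary event and choice of the constant *)

Lemma uniform_sample_probC {R : realType} (X : finType) (t : nat) (E : pred {set X}) :
  (t <= #|X|)%N ->
  uniform_sample_prob R t E = 1 - uniform_sample_prob R t (fun A => ~~ E A).
Proof.
move=> tX; rewrite /uniform_sample_prob.
have C0 : #|subsets_of_size X t|%:R != 0 :> R.
  by rewrite card_subsets_of_size pnatr_eq0 -lt0n bin_gt0.
apply: (mulIf C0); rewrite mulrBl !divfK // mul1r; apply/eqP.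
rewrite eq_sym subr_eq -natrD eqr_nat -(cardsID [set A | E A]).
by apply/eqP; congr (_ + _)%N; apply: eq_card => A; rewrite !inE // andbC.
Qed.

Theorem theorem3 (R : realType) :
  exists c1 : R, 0 < c1 /\
  forall (d : nat) (X : finType) (F : {set {set X}}),
    (1 <= d)%N ->
    (forall Y : {set X}, (d <= #|Y|)%N ->
       #|projection F Y|%:R <= (expR 1 * #|Y|%:R / d%:R) ^+ d :> R) ->
  forall delta eps gamma : R,
    0 < delta < 1 / 2 -> 0 < eps < 1 / 2 -> 0 < gamma < 1 / 2 ->
  forall t : nat,
    (t <= #|X|)%N ->
    c1 / (eps * delta ^+ 2) * (d%:R * ln (1 / (eps * delta)) + ln (1 / gamma))
      <= t%:R ->
    1 - gamma
      <= uniform_sample_prob R t (relative_approximation F eps delta).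
Proof.
(* 4608 = 16 · 288, so that mu = Lam t / 288 >= 16 (dL + G). Then mu / 8 >= 2dL >= (d + 1)L, which
   with 2 <= exp(L) gives the growth hypothesis of [failure_prob_le]. *)
exists 4608; split=> // d X F d1 trF delta eps gamma /andP[dl0 dl1] /andP[e0 e1]
  /andP[g0 g1] t tX.
set L := ln (1 / (eps * delta)); set G := ln (1 / gamma).
set Lam := eps * delta ^+ 2.
have ed0 : 0 < eps * delta by rewrite mulr_gt0.
have Lam0 : 0 < Lam by rewrite mulr_gt0 ?exprn_gt0.
have eL : expR L = 1 / (eps * delta) by rewrite lnK // posrE divr_gt0.
have eG : expR G = 1 / gamma by rewrite lnK // posrE divr_gt0.
have L4 : 4 <= expR L by rewrite eL ler_pdivlMr //; nra.
have G2 : 2 <= expR G by rewrite eG ler_pdivlMr //; lra.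
(* [expR_le_quadratic] at 1/2 gives exp(1/2) <= 2. The bound on L is what yields d <= t below. *)
have L0 : 1 / 2 <= L.
  rewrite -ler_expR; apply: le_trans L4; apply: le_trans (expR_le_quadratic _ _) _.
    by rewrite ger0_norm //; lra.
  by lra.
have G0 : 0 <= G by rewrite -ler_expR expR0; lra.
have Lam8 : Lam <= 1 / 8 by rewrite /Lam; nra.
rewrite mulrAC ler_pdivrMr // => ht.
have dr1 : 1 <= d%:R :> R by rewrite ler1n.
have dL : d%:R / 2 <= d%:R * L by rewrite ler_wpM2l //; lra.
have dt : (d <= t)%N.
  rewrite -(ler_nat R) -(ler_pM2r Lam0); apply: le_trans ht.
  by have : d%:R * Lam <= d%:R * (1 / 8) by [rewrite ler_wpM2l]; lra.
have t0 : (0 < t)%N by apply: leq_trans dt.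
have tr0 : 0 < t%:R :> R by rewrite ltr0n.
rewrite uniform_sample_probC // lerD2l lerN2.
apply: le_trans (failure_prob_le _ d _ _ _ trF t0 _ e0 _ _) _.
- by rewrite dt.
- by rewrite dl0 ltW.
- apply: (@le_trans _ _ (expR L ^+ d.+1)).
    by rewrite lerXn2r ?nnegrE ?expR_ge0 //; lra.
  rewrite -expRM_natl ler_expR -natr1 -/Lam.
  have : L <= d%:R * L by rewrite ler_peMl //; lra.
  by lra.
rewrite -/Lam; set mu := Lam * t%:R / 288.
(* From 1 + x <= expR x with x = mu / (4 d) - 1, using 1 / Lam <= expR (2 L)
   and 2304 <= expR (6 L). *)
have base : expR 1 * (2 * t%:R) / d%:R <= expR (8 * L + mu / (4 * d%:R)).
  have -> : expR 1 * (2 * t%:R) / d%:R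
      = (2304 / Lam) * (expR 1 * (1 + (mu / (4 * d%:R) - 1))).
    by rewrite /mu; field; rewrite !gt_eqF //; lra.
  rewrite expRD ler_pM //.
  - by rewrite divr_ge0 // ltW.
  - by rewrite subrKC mulr_ge0 ?expR_ge0 ?divr_ge0 ?mulr_ge0 // ltW.
  - have -> : expR (8 * L) = expR L ^+ 6 * expR L ^+ 2 :> R.
      by rewrite -exprD -expRM_natl.
    apply: ler_pM => //; first by rewrite invr_ge0 ltW.
      apply: (@le_trans _ _ (4 ^+ 6)); first by lra.
      by rewrite lerXn2r ?nnegrE ?expR_ge0.
    rewrite eL expr_div_n expr1n div1r lef_pV2 ?posrE ?exprn_gt0 // /Lam exprMn.
    by rewrite ler_pM2r ?exprn_gt0 //; nra.
  rewrite -[leRHS](_ : expR 1 * expR (mu / (4 * d%:R) - 1) = _).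
    by rewrite ler_wpM2l ?expR_ge0 // expR_ge1Dx.
  by rewrite -expRD; congr expR; ring.
(* The factor 4 is absorbed by exp(2G), as exp(G) = 1 / gamma >= 2. What remains is 3G + 8dL <= 3 mu
   / 4, and 3 mu / 4 >= 12 (dL + G). *)
apply: (@le_trans _ _ (expR (2 * G) * expR (8 * L + mu / (4 * d%:R)) ^+ d * expR (- mu))).
  rewrite ler_wpM2r ?expR_ge0 // ler_pM ?exprn_ge0 ?divr_ge0 ?mulr_ge0 ?expR_ge0 //.
    by rewrite mulr_natl mulr2n expRD; nra.
  by rewrite lerXn2r ?nnegrE ?divr_ge0 ?mulr_ge0 ?expR_ge0.
have -> : gamma = expR (- G) by rewrite expRN eG div1r invrK.
rewrite -expRM_natl -!expRD ler_expR.
have -> : d%:R * (8 * L + mu / (4 * d%:R)) = 8 * (d%:R * L) + mu / 4.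
  by field; rewrite gt_eqF //; lra.
by rewrite /mu; lra.
Qed.
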